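(* Let $E=(E^0,E^1,d,r)$ be a topological graph. An invariant set $X^0$ of $E^0$ is a maximal head if and only if $X_1^0\cup X_2^0\supset X^0$ implies either $X_1^0\supset X^0$ or $X_2^0\supset X^0$ for two invariant sets $X_1^0,X_2^0$.
   Context: A topological graph $E=(E^0,E^1,d,r)$ consists of two locally compact (Hausdorff) spaces $E^0,E^1$, a local homeomorphism $d\colon E^1\to E^0$ and a continuous map $r\colon E^1\to E^0$. Put $E^0_{\rm sce}=E^0\setminus\overline{r(E^1)}$, $E^0_{\rm fin}=\{v\in E^0: v$ has a neighborhood $V$ with $r^{-1}(V)$ compact$\}$, $E^0_{\rm rg}=E^0_{\rm fin}\setminus\overline{E^0_{\rm sce}}$. A subset $X^0\subset E^0$ is positively invariant if $d(e)\in X^0$ implies $r(e)\in X^0$ for $e\in E^1$; negatively invariant if for every $v\in X^0\cap E^0_{\rm rg}$ there is $e\in E^1$ with $r(e)=v$, $d(e)\in X^0$; invariant if both. $\mathrm{Orb}^+(v)$ is the set consisting of $v$ and all $r(e_1)$ for paths $(e_1,\dots,e_n)\in(E^1)^n$, $n\ge1$, with $d(e_k)=r(e_{k+1})$ for $1\le k<n$ and $d(e_n)=v$. A maximal head is a non-empty closed invariant set $X^0\subset E^0$ such that for any $v_1,v_2\in X^0$ and any neighborhoods $V_1,V_2$ of $v_1,v_2$ respectively, there is $v\in X^0$ with $\mathrm{Orb}^+(v)\cap V_1\neq\emptyset$ and $\mathrm{Orb}^+(v)\cap V_2\neq\emptyset$.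
   Formalization: The invariant sets X^0, X_1^0, X_2^0 are all taken to be closed, and X^0 non-empty; without this the claim fails (irrational rotation: the circle is a maximal head covered by one orbit and its complement, both invariant). *)

(* Defs.v *)
From mathcomp Require Import all_boot.
From mathcomp Require Import all_classical topology.

Set Implicit Arguments.
Unset Strict Implicit.
Unset Printing Implicit Defensive.

Local Open Scope classical_set_scope.

(* [f] restricts to a homeomorphism from [U] onto [f @` U], for the subspace
   topologies. *)
Definition homeomorphism_on (S T : topologicalType) (U : set S) (f : S -> T) :
    Prop :=
  exists g : T -> S, [/\ {in U, cancel f g}, {within U, continuous f}
    & {within f @` U, continuous g}].

Definition local_homeomorphism (S T : topologicalType) (f : S -> T) : Prop :=
  forall x : S, exists U : set S,
    [/\ open U, U x, open (f @` U) & homeomorphism_on U f].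

Record topologicalGraph := TopologicalGraph {
  vertex : topologicalType;
  edge : topologicalType;
  dom : edge -> vertex;
  ran : edge -> vertex;
  vertex_hausdorff : hausdorff_space vertex;
  vertex_locally_compact : locally_compact [set: vertex];
  edge_hausdorff : hausdorff_space edge;
  edge_locally_compact : locally_compact [set: edge];
  dom_local_homeomorphism : local_homeomorphism dom;
  ran_continuous : continuous ran
}.

Definition vertex_sce (E : topologicalGraph) : set (vertex E) :=
  ~` closure (range (@ran E)).

Definition vertex_fin (E : topologicalGraph) : set (vertex E) :=
  [set v | exists2 V : set (vertex E), nbhs v V & compact (@ran E @^-1` V)].

Definition vertex_rg (E : topologicalGraph) : set (vertex E) :=
  @vertex_fin E `\` closure (@vertex_sce E).

Definition positively_invariant (E : topologicalGraph) (X : set (vertex E)) :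
    Prop :=
  forall e : edge E, X (dom e) -> X (ran e).

Definition negatively_invariant (E : topologicalGraph) (X : set (vertex E)) :
    Prop :=
  forall v : vertex E, (X `&` @vertex_rg E) v ->
    exists e : edge E, ran e = v /\ X (dom e).

Definition invariant_set (E : topologicalGraph) (X : set (vertex E)) : Prop :=
  positively_invariant X /\ negatively_invariant X.

(* The non-empty path (e_1, ..., e_n) is [e :: p]; consecutive edges satisfy
   d(e_k) = r(e_(k+1)). *)
Definition positive_orbit (E : topologicalGraph) (v : vertex E) :
    set (vertex E) :=
  [set w | w = v \/
    exists (e : edge E) (p : seq (edge E)),
      [/\ path (fun e1 e2 : edge E => dom e1 == ran e2) e p,
          dom (last e p) = v & w = ran e]].

Definition maximal_head (E : topologicalGraph) (X : set (vertex E)) : Prop :=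
  [/\ X !=set0, closed X, invariant_set X
    & forall (v1 v2 : vertex E) (V1 V2 : set (vertex E)),
        X v1 -> X v2 -> nbhs v1 V1 -> nbhs v2 V2 ->
        exists v : vertex E, [/\ X v,
          positive_orbit v `&` V1 !=set0 & positive_orbit v `&` V2 !=set0]].

(* Main.v *)
(** Closed positively invariant sets contain the positive orbits of their points,
    whence the direct implication.  For the converse, suppose that neighborhoods
    [V1], [V2] of [v1], [v2] violate the maximal head condition in [X], and let
    [Pi] be the set of vertices whose positive orbit misses [Vi].  Then [X] is
    covered by [P1] and [P2], which are positively invariant but in general
    neither closed nor negatively invariant.  For a positively invariant [P], the
    smallest closed positively invariant [K] with [X `<=` K `|` P] is
    automatically negatively invariant: a regular vertex receiving no edge from
    [K] could be removed from [K], because the regular vertices receiving no edge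
    from [K] form an open set.  Replacing [P1] and then [P2] by such a set [K]
    gives closed invariant sets that cover [X]; they miss [v1] and [v2]
    respectively, since the closure of [Pi] is positively invariant and does not
    contain [vi]. *)

Require Import Defs.
From mathcomp Require Import all_boot.
From mathcomp Require Import all_classical topology.

Local Open Scope classical_set_scope.

Lemma local_homeomorphism_continuous (S T : topologicalType) (f : S -> T) :
  local_homeomorphism f -> continuous f.
Proof.
move=> f_lh x; have [U [oU Ux _ [g [_ f_cont _]]]] := f_lh x.
move: f_cont; rewrite continuous_open_subspace// => /(_ x); apply.
exact: mem_set.
Qed.

(** The local inverse [g] is continuous on an open set around [f x], so the preimage of [W] under
    [g] is a neighborhood there. *)
Lemma local_homeomorphism_nbhs (S T : topologicalType) (f : S -> T) (x : S)
    (W : set S) :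
  local_homeomorphism f -> nbhs x W -> nbhs (f x) (f @` W).
Proof.
move=> f_lh xW; have [U [oU Ux ofU [g [gK _ g_cont]]]] := f_lh x.
have fUx : (f @` U) (f x) by exists x.
move: g_cont; rewrite continuous_open_subspace// => /(_ (f x) (mem_set fUx)).
rewrite /continuous_at gK ?inE// => /(_ W xW) gW.
have gWU : nbhs (f x) (g @^-1` W `&` f @` U).
  by apply: filterI => //; exact: open_nbhs_nbhs.
apply: filterS gWU => y [Wgy [u Uu fu]].
by exists u => //; rewrite -(gK u) ?inE// fu.
Qed.

Section TopologicalGraph.
Variable E : topologicalGraph.
Implicit Types (X P K C V : set (vertex E)) (v : vertex E) (e : edge E).

(** As [dom] is open, the sources of edges ending near [ran e] fill a neighborhood of [dom e], which
    meets [P]. *)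
Lemma closure_positively_invariant P :
  positively_invariant P -> positively_invariant (closure P).
Proof.
move=> Ppos e Pde B rB.
have dB : nbhs (dom e) (@dom E @` (@ran E @^-1` B)).
  apply: local_homeomorphism_nbhs; first exact: dom_local_homeomorphism.
  exact: (@ran_continuous E e).
have [w [Pw [e' Be' de']]] := Pde _ dB.
by exists (ran e'); split => //; apply: Ppos; rewrite de'.
Qed.

Lemma positive_orbit_edge e : positive_orbit (ran e) `<=` positive_orbit (dom e).
Proof.
move=> w [->|[e1 [p [e1p de1 we1]]]]; right; first by exists e, [::].
by exists e1, (rcons p e); rewrite rcons_path e1p last_rcons de1 eqxx.
Qed.

Definition orbit_avoiding V : set (vertex E) :=
  [set v | ~ (positive_orbit v `&` V !=set0)].

Lemma orbit_avoiding_positively_invariant V :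
  positively_invariant (orbit_avoiding V).
Proof.
move=> e Vde [w [rw Vw]]; apply: Vde; exists w; split => //.
exact: positive_orbit_edge.
Qed.

Lemma notin_closure_orbit_avoiding v V :
  nbhs v V -> ~ closure (orbit_avoiding V) v.
Proof.
by move=> vV /(_ _ vV) [w [Vw' Vw]]; apply: Vw'; exists w; split => //; left.
Qed.

(** The edges into a suitable [V] form a compact set, so those with source in [K] have compact,
    hence closed, range. *)
Lemma open_vertex_rg_setD_ran K :
  closed K -> open (@vertex_rg E `\` (@ran E @` (@dom E @^-1` K))).
Proof.
move=> Kcl; rewrite openE => v [[[V vV cV] Nsce] NrK].
have dK : closed (@dom E @^-1` K).
  apply: preimage_closed => // e _; apply: local_homeomorphism_continuous.
  exact: dom_local_homeomorphism.
pose A := @ran E @` (@ran E @^-1` V `&` @dom E @^-1` K).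
have clA : closed A.
  apply: compact_closed; first exact: vertex_hausdorff.
  apply: continuous_compact.
    by apply: continuous_subspaceT; exact: ran_continuous.
  exact: compact_closedI.
have NA : ~ A v by move=> [e [_ Ke] re]; apply: NrK; exists e.
have vNA : nbhs v (~` A).
  by apply: open_nbhs_nbhs; split => //; rewrite openC.
have vNsce : nbhs v (~` closure (@vertex_sce E)).
  by apply: open_nbhs_nbhs; split => //; rewrite openC; exact: closed_closure.
have vW : nbhs v (~` A `&` ~` closure (@vertex_sce E) `&` V°).
  by apply: filterI; [exact: filterI|exact: nbhs_interior].
apply: filterS vW => w [[NAw Nw] Vw]; split; first by split => //; exists V.
move=> [e Ke re]; apply: NAw; exists e => //; split => //.
by rewrite /preimage/= re; exact: nbhs_singleton.
Qed.

Definition residual X P : set (vertex E) :=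
  [set v | forall C, closed C -> positively_invariant C -> X `<=` C `|` P -> C v].

Lemma closed_residual X P : closed (residual X P).
Proof.
move=> v clv C Ccl Cpos XCP; apply: (Ccl) => B vB.
by have [w [Kw Bw]] := clv _ vB; exists w; split => //; exact: Kw.
Qed.

Lemma residual_cover X P : X `<=` residual X P `|` P.
Proof.
move=> x Xx; have [Px|NPx] := pselect (P x); first by right.
by left => C _ _ /(_ x Xx) [].
Qed.

Lemma residual_positively_invariant X P : positively_invariant (residual X P).
Proof. by move=> e Kde C Ccl Cpos XCP; apply: (Cpos); exact: Kde. Qed.

Lemma residual_invariant X P :
  negatively_invariant X -> positively_invariant P ->
  invariant_set (residual X P).
Proof.
move=> Xneg Ppos; split; first exact: residual_positively_invariant.
set K := residual X P.
pose K' := K `\` (@vertex_rg E `\` (@ran E @` (@dom E @^-1` K))).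
suff KK' : K `<=` K'.
  move=> v [Kv rgv]; have [_ NNv] := KK' _ Kv.
  by apply: contrapT => Ne; apply: NNv; split => // -[e Kde re]; apply: Ne; exists e.
(* By minimality of [K], it suffices that [K'] is one of the sets intersected in [residual]. *)
move=> v; apply.
- rewrite /K' setDE; apply: closedI; first exact: closed_residual.
  by rewrite closedC; apply: open_vertex_rg_setD_ran; exact: closed_residual.
- move=> e [Kde _]; split; first exact: residual_positively_invariant.
  by move=> [_]; apply; exists e.
- move=> x Xx; have [Px|NPx] := pselect (P x); first by right.
  left; split; first by have [|] := residual_cover X P x Xx.
  (* The source of [e] avoids [P], since otherwise [x] would lie in [P]; hence it lies in [K]. *)
  move=> [rgx]; apply; have [e [re Xde]] := Xneg x (conj Xx rgx).
  exists e => //; have [//|Pde] := residual_cover X P _ Xde.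
  by exfalso; apply: NPx; rewrite -re; exact: Ppos.
Qed.

(** The closure of [orbit_avoiding V] competes in the definition of [residual X P] and omits [v]. *)
Lemma notin_residual X P V v :
  nbhs v V -> X `<=` orbit_avoiding V `|` P -> ~ residual X P v.
Proof.
move=> vV XVP Kv; apply: (notin_closure_orbit_avoiding v V vV); apply: Kv.
- exact: closed_closure.
- by apply: closure_positively_invariant; exact: orbit_avoiding_positively_invariant.
- by apply: subset_trans XVP _; apply: setSU; exact: subset_closure.
Qed.

Lemma positive_orbit_sub C v :
  positively_invariant C -> C v -> positive_orbit v `<=` C.
Proof.
move=> Cpos Cv _ [->//|[e [p [ep dv ->]]]].
elim: p e ep dv => [|e' p IHp] e /=; first by move=> _ de; apply: Cpos; rewrite de.
by move=> /andP[/eqP de e'p] dv; apply: Cpos; rewrite de; exact: IHp.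
Qed.

End TopologicalGraph.

Theorem proposition5p9 (E : topologicalGraph) (X : set (vertex E))
    (X_neq0 : X !=set0) (X_closed : closed X) (X_invariant : invariant_set X) :
  maximal_head X <->
  (forall X1 X2 : set (vertex E),
     closed X1 -> invariant_set X1 -> closed X2 -> invariant_set X2 ->
     X `<=` X1 `|` X2 -> X `<=` X1 \/ X `<=` X2).
Proof.
split=> [[_ _ _ Xhead] X1 X2 X1cl [X1pos _] X2cl [X2pos _] XX12|Xprime].
  apply: contrapT => /not_orP[/existsNP[v1 /not_implyP[Xv1 NX1v1]]].
  move=> /existsNP[v2 /not_implyP[Xv2 NX2v2]].
  have [||v [Xv [w1 [ow1 Nw1]] [w2 [ow2 Nw2]]]] :=
      Xhead v1 v2 (~` X1) (~` X2) Xv1 Xv2.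
  - by apply: open_nbhs_nbhs; split => //; rewrite openC.
  - by apply: open_nbhs_nbhs; split => //; rewrite openC.
  have [X1v|X2v] := XX12 v Xv.
  - by apply: Nw1; exact: positive_orbit_sub ow1.
  - by apply: Nw2; exact: positive_orbit_sub ow2.
split=> // v1 v2 V1 V2 Xv1 Xv2 vV1 vV2; apply: contrapT => Nhead.
have [_ Xneg] := X_invariant.
set P1 := orbit_avoiding E V1; set P2 := orbit_avoiding E V2.
have XP12 : X `<=` P1 `|` P2.
  move=> v Xv; apply: contrapT => /not_orP[/contrapT v1' /contrapT v2'].
  by apply: Nhead; exists v.
(* Taking [X1] rather than [P1] in [X2] makes the two cover [X]; [X2] still omits [v2], as [P2] and
   [X1] cover [X]. *)
pose X1 := residual E X P2; pose X2 := residual E X X1.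
have X1inv : invariant_set X1.
  by apply: residual_invariant => //; exact: orbit_avoiding_positively_invariant.
have X2inv : invariant_set X2 by apply: residual_invariant => //; case: X1inv.
have XX12 : X `<=` X1 `|` X2 by rewrite setUC; exact: residual_cover.
have [XX1|XX2] := Xprime X1 X2 (closed_residual _ _ _) X1inv
    (closed_residual _ _ _) X2inv XX12.
- by apply: (@notin_residual E X P2 V1 v1) => //; exact: XX1.
- apply: (@notin_residual E X X1 V2 v2) => //; last exact: XX2.
  by rewrite setUC; exact: residual_cover.
Qed.
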